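(* Let $(X_t)_{t\in\mathbb{Z}}$ be a centered strictly stationary process with finite second moments satisfying $X_t-\phi X_{t-1}=Z_t$ for every $t\in\mathbb{Z}$, where $\phi=e^{-H}$ for some $H>0$ and $(Z_t)_{t\in\mathbb{Z}}$ is a strictly stationary process. Let $\gamma(n)=\operatorname{cov}(X_t,X_{t+n})$, $r(n)=\operatorname{cov}(Z_t,Z_{t+n})$, and let $N\in\mathbb{N}$ be fixed. Put $$g(x_1,x_2,x_3)=(x_1+x_3)^2-4x_2(x_2-r(N)),\qquad \boldsymbol{\gamma}=[\gamma(N+1),\gamma(N),\gamma(N-1)]^\top,$$ and let $\hat{\boldsymbol{\gamma}}_T=[\hat\gamma_T(N+1),\hat\gamma_T(N),\hat\gamma_T(N-1)]^\top$ be an estimator of $\boldsymbol{\gamma}$ based on observations $(X_1,\ldots,X_T)$. Define $\hat\phi_T$ as the truncation to $[0,1]$ of $$\frac{\hat\gamma_T(N+1)+\hat\gamma_T(N-1)+\sqrt{g(\hat{\boldsymbol{\gamma}}_T)}\,\mathbf{1}_{\{g(\hat{\boldsymbol{\gamma}}_T)>0\}}}{2\hat\gamma_T(N)}\,\mathbf{1}_{\{\hat\gamma_T(N)\neq0\}}.$$ Assume that $\gamma(N)\neq0$, that $g(\boldsymbol{\gamma})>0$, that $\phi=\dfrac{\gamma(N+1)+\gamma(N-1)+\sqrt{g(\boldsymbol{\gamma})}}{2\gamma(N)}$, and that $\hat{\boldsymbol{\gamma}}_T$ is consistent for $\boldsymbol{\gamma}$. If $$l(T)(\hat{\boldsymbol{\gamma}}_T-\boldsymbol{\gamma})\xrightarrow{\text{law}}\mathcal{N}(\mathbf{0},\Sigma)\quad\text{as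 }T\to\infty$$ for some covariance matrix $\Sigma$ and some rate function $l(T)$, then $l(T)(\hat\phi_T-\phi)$ is asymptotically normal with zero mean and variance $$\Sigma_\phi=\frac{1}{4\gamma(N)^2}\left(\bigl(\nabla\sqrt{g(\boldsymbol{\gamma})}\bigr)^\top\Sigma\,\nabla\sqrt{g(\boldsymbol{\gamma})}+2\begin{bmatrix}1\\-C_N\\1\end{bmatrix}^\top\Sigma\,\nabla\sqrt{g(\boldsymbol{\gamma})}+\begin{bmatrix}1\\-C_N\\1\end{bmatrix}^\top\Sigma\begin{bmatrix}1\\-C_N\\1\end{bmatrix}\right),$$ that is, $l(T)(\hat\phi_T-\phi)\xrightarrow{\text{law}}\mathcal{N}(0,\Sigma_\phi)$ as $T\to\infty$, where $$C_N=\frac{\gamma(N+1)+\gamma(N-1)+\sqrt{g(\boldsymbol{\gamma})}}{\gamma(N)},\qquad \nabla\sqrt{g(\boldsymbol{\gamma})}=\frac{1}{\sqrt{g(\boldsymbol{\gamma})}}\begin{bmatrix}\gamma(N+1)+\gamma(N-1)\\2(r(N)-2\gamma(N))\\\gamma(N+1)+\gamma(N-1)\end{bmatrix}.$$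
   Context: All processes are real-valued. A process $X=(X_t)_{t\in\mathbb{Z}}$ is strictly stationary if $(X_{t+n_1},\ldots,X_{t+n_k})$ and $(X_{n_1},\ldots,X_{n_k})$ have the same law for all $k\in\mathbb{N}$ and $t,n_1,\ldots,n_k\in\mathbb{Z}$. Centered means $\mathbb{E}(X_t)=0$ for every $t$. Consistency means convergence in probability to the true value as $T\to\infty$. The truncation to $[0,1]$ of a real number $y$ is $y$ if $y\in[0,1]$, $0$ if $y<0$, and $1$ if $y>1$. Terms multiplied by an indicator are $0$ when the indicator is $0$. The estimators $\hat\gamma_T(n)$ are arbitrary real-valued random variables (functions of the observations); no specific form is assumed. A rate function is a positive function $l$ with $l(T)\to\infty$ as $T\to\infty$. Normal distributions may be degenerate ($\Sigma$ is symmetric positive semidefinite; $\mathcal{N}(0,0)$ is the point mass at $0$). *)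

(* Defs.v *)
From HB Require Import structures.
From mathcomp Require Export all_boot all_order all_algebra.
From mathcomp Require Export all_classical all_reals all_analysis.

Set Implicit Arguments.
Unset Strict Implicit.
Unset Printing Implicit Defensive.

Import Order.TTheory GRing.Theory Num.Theory.
Import numFieldNormedType.Exports.

Local Open Scope classical_set_scope.
Local Open Scope ring_scope.

Section Processes.
Context d (Om : measurableType d) (R : realType) (P : probability Om R).
Implicit Type X : int -> {RV P >-> R}.

(* Laws on R^k are compared on the product sigma-algebra of [k.-tuple R]. *)
Definition strictly_stationary X :=
  forall (k : nat) (t : int) (n : 'I_k -> int) (A : set (k.-tuple R)),
    measurable A ->
    pushforward P (fun w => [tuple X (t + n i) w | i < k]) A =
    pushforward P (fun w => [tuple X (n i) w | i < k]) A.

Definition centered X := forall t, ('E_P[X t] = 0)%E.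

Definition finite_second_moments X :=
  forall t, (X t : Om -> R) \in Lfun P 2%:E.

(* Base time 0: by stationarity, cov (X t) (X (t + n)) does not depend on t. *)
Definition autocov X (n : int) : R := fine (covariance P (X 0) (X n)).

Definition observations X (T : nat) (w : Om) : T.-tuple R :=
  [tuple X (i.+1)%:Z w | i < T].

End Processes.

Section Convergence.
Context d (Om : measurableType d) (R : realType) (P : probability Om R).

(* The event is measurable as soon as the coordinates of [Y n] are. *)
Definition cvg_in_probability (V : normedModType R)
    (Y : nat -> Om -> V) (y : V) :=
  forall e : R, 0 < e ->
    P [set w | e <= `|Y n w - y|] @[n --> \oo] --> 0%E.

(* The limit is given as a random element [Z], possibly on another
   probability space. *)
Definition cvg_in_law d' (Om' : measurableType d') (P' : probability Om' R)
    (V : topologicalType) (Y : nat -> Om -> V) (Z : Om' -> V) :=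
  forall f : V -> R, continuous f -> (exists M, forall x, `|f x| <= M) ->
    ('E_P[f \o Y n])%E @[n --> \oo] --> ('E_P'[f \o Z])%E.

End Convergence.

Section Normal.
Context {R : realType}.

(* The law N(m, v), parametrized by its variance.  The degenerate case must be
   split off since [normal_prob m 0] is the uniform law on [0, 1]. *)
Definition normal_law (m v : R) : probability (measurableTypeR R) R :=
  if 0 < v then normal_prob m (Num.sqrt v) : probability (measurableTypeR R) R
  else @dirac _ (measurableTypeR R) m R : probability (measurableTypeR R) R.

Definition covariance_matrix (n : nat) (S : 'M[R]_n) :=
  S^T = S /\ forall a : 'cV[R]_n, 0 <= (a^T *m S *m a) 0 0.

(* Y ~ N(m, S): every linear form a^T Y has law N(a^T m, a^T S a). *)
Definition normal_vector d (Om : measurableType d) (P : probability Om R)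
    (n : nat) (Y : Om -> 'cV[R]_n) (m : 'cV[R]_n) (S : 'M[R]_n) :=
  forall a : 'cV[R]_n,
    measurable_fun setT (fun w => (a^T *m Y w) 0 0) /\
    forall A : set R, measurable A ->
      pushforward P (fun w => (a^T *m Y w) 0 0) A =
      normal_law ((a^T *m m) 0 0) ((a^T *m S *m a) 0 0) A.

End Normal.

Section Estimator.
Context {R : realType}.

Definition vec3 (a b c : R) : 'cV[R]_3 := \col_i tnth [tuple a; b; c] i.

Definition bilform (n : nat) (S : 'M[R]_n) (v w : 'cV[R]_n) : R :=
  (v^T *m S *m w) 0 0.

Definition gradient (n : nat) (f : 'cV[R]_n -> R) (x : 'cV[R]_n) : 'cV[R]_n :=
  \col_i 'D_(delta_mx i 0) f x.

(* [rN] is r(N); (x 0 0, x 1 0, x 2 0) is (x_1, x_2, x_3). *)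
Definition g (rN : R) (x : 'cV[R]_3) : R :=
  (x 0 0 + x 2 0) ^+ 2 - 4 * x 1 0 * (x 1 0 - rN).

Definition sqrt_g (rN : R) (x : 'cV[R]_3) : R := Num.sqrt (g rN x).

Definition trunc01 (y : R) : R :=
  if y < 0 then 0 else if 1 < y then 1 else y.

Definition phi_of (rN : R) (x : 'cV[R]_3) : R :=
  trunc01 (if x 1 0 != 0 then
             (x 0 0 + x 2 0 + (if 0 < g rN x then sqrt_g rN x else 0))
               / (2 * x 1 0)
           else 0).

(* (c (N + 1), c N, c (N - 1)); lags are integers, so that N = 0 is allowed. *)
Definition lag_vec (c : int -> R) (N : nat) : 'cV[R]_3 :=
  vec3 (c (N%:Z + 1)) (c N%:Z) (c (N%:Z - 1)).

Definition C_N (rN : R) (x : 'cV[R]_3) : R :=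
  (x 0 0 + x 2 0 + sqrt_g rN x) / x 1 0.

Definition Sigma_phi (rN : R) (x : 'cV[R]_3) (S : 'M[R]_3) : R :=
  let D := gradient (sqrt_g rN) x in
  let c := vec3 1 (- C_N rN x) 1 in
  (4 * x 1 0 ^+ 2)^-1 *
  (bilform S D D + 2 * bilform S c D + bilform S c c).

End Estimator.

(* Main.v *)
(* Near gamma the estimator is h, the root with the + sign of
   x_2 z^2 - (x_1 + x_3) z + (x_2 - r(N)) = 0: since phi = h(gamma) lies in
   ]0, 1[, the truncation is locally inactive.  So the theorem is the delta
   method for h.

   For the delta method, the rescaled increments
   l(T) (h(x + v / l(T)) - h(x)) converge to 'd h x v uniformly for v in a
   bounded set.  The complement is controlled by a bounded continuous cutoff, to
   which the convergence in law applies directly, so no tightness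
   theorem is needed.  The limit 'd h x G is the linear form
   (grad h)^T G of a normal vector, of variance (grad h)^T Sigma (grad h). *)

From HB Require Import structures.
Require Import Defs.
From mathcomp Require Import measurable_realfun ring lra.

Set Implicit Arguments.
Unset Strict Implicit.
Unset Printing Implicit Defensive.

Import Order.TTheory GRing.Theory Num.Theory.
Import numFieldNormedType.Exports.

Local Open Scope classical_set_scope.
Local Open Scope ring_scope.

(** * Preliminaries on real functions *)

(** Writing $1/x = x\,(x^2)^{-1}$ reduces the claim to a real power of the nonnegative number $x^2$,
    which is measurable; at $x = 0$ both sides are $0$. *)
Lemma measurable_invr (R : realType) : measurable_fun [set: R] (@GRing.inv R).
Proof.
rewrite (_ : GRing.inv = fun x : R => x * (x ^+ 2) `^ (-1)).
  apply: measurable_funM => //.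
  have h := (@measurable_powR R (-1)).
  have h2 := @exprn_measurable R setT 2.
  exact: (measurableT_comp h h2).
apply/funext => x; rewrite powR_inv1 ?sqr_ge0//.
have [->|x0] := eqVneq x 0; first by rewrite invr0 mul0r.
by rewrite expr2 invfM mulrA divff// mul1r.
Qed.

(** Heine's argument on the compact segment $[-K, K]$. Only [y] is confined to the segment: [z] may
    leave it, as the rescaled increments will. *)
Lemma continuous_bounded_segment (R : realType) (f : R -> R) (K e : R) :
    continuous f -> 0 < e ->
  exists2 D, 0 < D &
    forall y z, `|y| <= K -> `|z - y| < D -> `|f z - f y| < e.
Proof.
move=> cf e0.
(* The covering is parametrized by the radius [D] tending to $0$ from the right, so that local radii
   merge into a uniform one. *)
have /compact_near_coveringP := @segment_compact R (- K) K.
move=> /(_ R (0 : R)^'+ (fun D y => forall z, `|z - y| < D -> `|f z - f y| < e)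
  _) [].
  move=> x _; have /cvgrPdist_lt/(_ _ (divr_gt0 e0 (ltr0Sn R 1))) := cf x.
  move=> /nbhs_ballP[r /= r0 xr].
  (* With both radii at most $r/2$, [y] and [z] lie within $r$ of the centre [x]. *)
  exists (ball x (r / 2), [set D | 0 < D < r / 2]) => /=.
    split; first by apply: nbhsx_ballx; rewrite divr_gt0.
    near=> D; apply/andP; split; near: D; first exact: nbhs_right_gt.
    by apply: nbhs_right_lt; rewrite divr_gt0.
  move=> [y D] /= [xy /andP[D0 Dr]] z zy.
  have h u : `|x - u| < r -> `|f u - f x| < e / 2.
    by move=> xu; rewrite distrC; exact: xr.
  have hz : `|f z - f x| < e / 2.
    apply: h; rewrite (splitr r) (le_lt_trans (ler_distD y _ _))// ltrD//.
    by rewrite distrC (lt_trans zy).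
  have hy : `|f x - f y| < e / 2.
    rewrite distrC; apply: h; rewrite (lt_trans xy)//.
    by rewrite ltr_pdivrMr// ltr_pMr// ltr1n.
  by rewrite (splitr e) (le_lt_trans (ler_distD (f x) _ _))// ltrD.
move=> D /= D0 h.
exists (D / 2); first by rewrite divr_gt0.
move=> y z yK; apply: (h (D / 2)); rewrite /= ?sub0r ?normrN.
- by rewrite gtr0_norm ?divr_gt0// ltr_pdivrMr// ltr_pMr// ltr1n.
- by rewrite divr_gt0.
- by rewrite in_itv/= -ler_norml.
Unshelve. all: by end_near. Qed.

(** * Expectations of bounded random variables *)

Section expectation_bounded.
Context d (Om : measurableType d) (R : realType) (P : probability Om R).
Implicit Types A B C : Om -> R.

Lemma bounded_Lfun1 A (M : R) : measurable_fun setT A ->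
  (forall w, `|A w| <= M) -> A \in Lfun P 1.
Proof.
move=> mA AM; apply/Lfun1_integrable.
apply: measurable_bounded_integrable => //.
  exact: fin_num_fun_lty.
exists M; split; first exact: num_real.
by move=> x Mx w _; rewrite /= (le_trans (AM w))// ltW.
Qed.

Lemma dist_expectation_le A B C :
  A \in Lfun P 1 -> B \in Lfun P 1 -> C \in Lfun P 1 ->
  (forall w, `|A w - B w| <= C w) ->
  (`| 'E_P[A] - 'E_P[B] | <= 'E_P[C])%E.
Proof.
move=> iA iB iC ABC; rewrite -expectationB// unlock.
have /Lfun1_integrable/integrableP[mAB _] : A \- B \in Lfun P 1.
  by rewrite rpredB.
have /Lfun1_integrable/integrableP[mC _] := iC.
apply: (le_trans (le_abse_integral _ measurableT mAB)).
apply: ge0_le_integral => //; first exact: measurableT_comp.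
by move=> w _; rewrite lee_fin ABC.
Qed.

End expectation_bounded.

(** * A bounded continuous cutoff at infinity *)

Section excess.
Context {R : realType} {n : nat}.
Implicit Types (x : 'cV[R]_n).

(** A continuous substitute for the indicator of large vectors: $0$ where the $\ell^1$ norm is at
    most $K$, $1$ where it is at least $K+1$. The $\ell^1$ norm reduces continuity and measurability
    to the coordinates. *)
Definition excess (K : R) x := Num.min 1 (Num.max 0 (\sum_i `|x i 0| - K)).

Lemma excess_ge0 K x : 0 <= excess K x.
Proof. by rewrite /excess le_min ler01 le_max lexx. Qed.

Lemma excess_le1 K x : excess K x <= 1.
Proof. by rewrite /excess ge_min lexx. Qed.

Lemma excess_normr_le1 K x : `|excess K x| <= 1.
Proof. by rewrite ger0_norm ?excess_ge0 ?excess_le1. Qed.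

(** The norm on matrices is the maximum norm, which the $\ell^1$ norm dominates. *)
Lemma excess_lt1 K x : excess K x < 1 -> `|x| <= K + 1.
Proof.
rewrite /excess gt_min ltxx/= gt_max ltr01/= ltrBlDl => /ltW sK.
rewrite [leLHS]mx_normrE bigmax_le//=.
  by rewrite (le_trans _ sK)// sumr_ge0.
move=> [i j] _ /=; rewrite (le_trans _ sK)// (bigD1 i)//= ord1 lerDl.
by rewrite sumr_ge0.
Qed.

Lemma excess_cvg0 x : excess k%:R x @[k --> \oo] --> 0.
Proof.
apply: cvg_near_cst; near=> k; rewrite /excess.
have /max_idPl -> : \sum_i `|x i 0| - k%:R <= 0.
  by rewrite subr_le0; near: k; exact: nbhs_infty_ger.
by rewrite min_r.
Unshelve. all: by end_near. Qed.

Lemma continuous_excess K : continuous (excess K : 'cV[R]_n -> R).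
Proof.
move=> x; pose s (x : 'cV[R]_n) : R^o := \sum_i `|x i 0|.
apply: (@continuous_min R _ (cst 1) (cst 0 \max (s \- cst K))).
  exact: cst_continuous.
apply: continuous_max; first exact: cst_continuous.
apply: (@continuousB R R^o); last exact: cst_continuous.
apply: (continuous_big add_continuous) => i _ y.
by apply: continuous_comp; [exact: coord_continuous|exact: norm_continuous].
Qed.

Lemma measurable_excess d (Om : measurableType d) (W : Om -> 'cV[R]_n) K :
  (forall i, measurable_fun setT (fun w => W w i 0)) ->
  measurable_fun setT (fun w => excess K (W w)).
Proof.
move=> mW; apply: measurable_minr => //; apply: measurable_maxr => //.
apply: measurable_funB => //; apply: measurable_sum => i.
exact: measurableT_comp.
Qed.

End excess.

(** Tightness of a single law, by dominated convergence with the constant $1$ as dominating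
    function. *)
Lemma expectation_excess_cvg0 d (Om : measurableType d) (R : realType)
    (P : probability Om R) n (W : Om -> 'cV[R]_n) :
  (forall i, measurable_fun setT (fun w => W w i 0)) ->
  'E_P[excess k%:R \o W]%E @[k --> \oo] --> 0%E.
Proof.
move=> mW; rewrite unlock.
rewrite (_ : 0%E = \int[P]_w cst 0%E w)%E; last by rewrite integral0.
apply: (@dominated_cvg _ _ _ P setT measurableT
  (fun k w => (excess k%:R (W w))%:E) (cst 0%E) (cst 1%E)) => //.
- by move=> k; apply/measurable_EFinP; exact: measurable_excess.
- by move=> w _; apply: cvg_EFin; [exact: nearW|exact: excess_cvg0].
- exact: finite_measure_integrable_cst.
- by move=> k w _; rewrite /= lee_fin excess_normr_le1.
Qed.

(** * First-order expansion, uniform on bounded sets *)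

Lemma differentiable_remainder (R : realType) (V : normedModType R)
    (h : V -> R) (x : V) (e : R) :
    differentiable h x -> 0 < e ->
  exists2 r, 0 < r &
    forall v, `|v| < r -> `|h (x + v) - h x - 'd h x v| <= e * `|v|.
Proof.
move=> /diff_locally /eqaddoP /[apply] /nbhs_normP[r /= r0 hr].
exists r => // v vr; have := hr v.
rewrite /= sub0r normrN => /(_ vr).
by rewrite !fctE opprD addrA [v + x]addrC.
Qed.

(** At $v/l(T)$ the remainder is at most a small multiple of $|v|/l(T)$; multiplication by $l(T)$
    leaves a small multiple of $|v|$, which is bounded. Uniform continuity of [f] around the bounded
    set of values ['d h x v] then concludes. *)
Lemma scaled_increment_unif (R : realType) (V : normedModType R)
    (h : V -> R) (x : V) (l : nat -> R) (f : R -> R) (K e : R) :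
    differentiable h x -> l T @[T --> \oo] --> +oo -> continuous f -> 0 < e ->
  \forall T \near \oo, forall v, `|v| <= K ->
    `|f (l T * (h (x + (l T)^-1 *: v) - h x)) - f ('d h x v)| < e.
Proof.
move=> dh loo cf e0.
have [k k0 hk] := linear_lipschitz (diff_continuous dh).
have [D D0 hD] := continuous_bounded_segment (k * K) cf e0.
(* The slope $D/(|K|+1)$ makes the rescaled remainder strictly less than $D$ for $|v| \le |K|$,
   whatever the sign of [K]. *)
have K1 : 0 < `|K| + 1 by rewrite ltr_wpDl.
have [r r0 hr] := differentiable_remainder dh (divr_gt0 D0 K1).
near=> T => v vK.
have vK' : `|v| <= `|K| by rewrite (le_trans vK) ?ler_norm.
have lT0 : 0 < l T by near: T; move/cvgryPgt: loo; exact.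
have lTr : `|K| / r < l T by near: T; move/cvgryPgt: loo; exact.
apply: hD; first by rewrite (le_trans (hk v))// ler_pM2l.
have {hr} := hr ((l T)^-1 *: v).
rewrite linearZ/= normrZ gtr0_norm ?invr_gt0// mulrC ltr_pdivrMr//.
rewrite ltr_pdivrMr// mulrC in lTr.
move=> /(_ (le_lt_trans vK' lTr)); rewrite -(ler_pM2l lT0) => hr.
have -> : l T * (h (x + (l T)^-1 *: v) - h x) - 'd h x v =
          l T * (h (x + (l T)^-1 *: v) - h x - (l T)^-1 * 'd h x v).
  by rewrite [RHS]mulrBr mulrA divff ?gt_eqF// mul1r.
rewrite normrM gtr0_norm// (le_lt_trans hr)//.
rewrite [_ / l T]mulrC mulrCA mulVKf ?gt_eqF//.
by rewrite mulrAC ltr_pdivrMr// ltr_pM2l// ltr_pwDr.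
Unshelve. all: by end_near. Qed.

Lemma diff_coordE (R : realType) n (h : 'cV[R]_n -> R) (x v : 'cV[R]_n) :
  'd h x v = \sum_i v i 0 * 'd h x (delta_mx i 0).
Proof.
rewrite [in LHS](matrix_sum_delta v) linear_sum/=; apply: eq_bigr => i _.
by rewrite big_ord1 linearZ.
Qed.

(** * The delta method *)

Section delta_method.
Context d (Om : measurableType d) (R : realType) (P : probability Om R).
Context d' (Om' : measurableType d') (P' : probability Om' R).

Lemma delta_method n (Y : nat -> Om -> 'cV[R]_n) (x : 'cV[R]_n)
    (l : nat -> R) (G : Om' -> 'cV[R]_n) (h : 'cV[R]_n -> R) :
    (forall T i, measurable_fun setT (fun w => Y T w i 0)) ->
    (forall T, measurable_fun setT (fun w => h (Y T w))) ->
    (forall i, measurable_fun setT (fun w => G w i 0)) ->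
    differentiable h x -> l T @[T --> \oo] --> +oo ->
    cvg_in_law P P' (fun T w => l T *: (Y T w - x)) G ->
  cvg_in_law P P' (fun T w => l T * (h (Y T w) - h x)) ('d h x \o G).
Proof.
move=> mY mhY mG dh loo YG f cf [M fM].
pose W T w := l T *: (Y T w - x).
have mW T i : measurable_fun setT (fun w => W T w i 0).
  rewrite (_ : (fun _ => _) = fun w => l T * (Y T w i 0 - x i 0)).
    by apply: measurable_funM => //; apply: measurable_funB.
  by apply/funext => w; rewrite !mxE.
pose A T := f \o (fun w => l T * (h (Y T w) - h x)).
pose B T := (f \o 'd h x) \o W T.
have M0 : 0 <= M by rewrite (le_trans _ (fM 0)).
have mf : measurable_fun setT f by exact: continuous_measurable_fun.
have iA T : A T \in Lfun P 1.
  apply: bounded_Lfun1 => [|w]; last exact: fM.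
  apply: measurableT_comp => //; apply: measurable_funM => //.
  exact: measurable_funB.
have mdW T : measurable_fun setT ('d h x \o W T).
  rewrite (_ : 'd h x \o W T =
      fun w => \sum_i W T w i 0 * 'd h x (delta_mx i 0)).
    by apply: measurable_sum => i; apply: measurable_funM.
  by apply/funext => w /=; rewrite diff_coordE.
have iB T : B T \in Lfun P 1.
  apply: bounded_Lfun1 => [|w]; last exact: fM.
  by apply: (@measurableT_comp _ _ _ _ _ _ f _ ('d h x \o W T)).
(* The linearized variables need no estimate: [f \o 'd h x] is itself a bounded continuous test
   function for the hypothesis. *)
have BG : 'E_P[B T]%E @[T --> \oo] --> 'E_P'[f \o ('d h x \o G)]%E.
  apply: (YG (f \o 'd h x)); last by exists M => v; exact: fM.
  move=> v; apply: continuous_comp; [exact: diff_continuous|exact: cf].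
suff AB : ('E_P[A T] - 'E_P[B T])%E @[T --> \oo] --> 0%E.
  rewrite -['E_P'[_]%E]add0e.
  rewrite (_ : (fun T => _) =
      fun T => ('E_P[A T] - 'E_P[B T] + 'E_P[B T])%E); last first.
    by apply/funext => T; rewrite subeK// expectation_fin_num.
  by apply: cvgeD => //; rewrite fin_num_adde_defl.
apply/fine_cvgP; split.
  by apply: nearW => T; rewrite fin_numB !expectation_fin_num.
apply/cvgrPdist_lt => e e0.
(* This bound on the expected cutoff gives $2M \cdot e/(4(M+1)) < e/2$; the $+1$ covers $M = 0$. *)
have del0 : 0 < e / (4 * (M + 1)) by rewrite divr_gt0// mulr_gt0// ltr_pwDr.
(* [K] is chosen for the limit [G] alone; [excW] below carries the bound over to [W T] for large
   [T]. *)
have [K excG] : exists K, ('E_P'[excess K \o G] < (e / (4 * (M + 1)))%:E)%E.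
  have /fine_cvgP[fG /cvgrPdist_lt/(_ _ del0) excG] :=
    expectation_excess_cvg0 P' mG.
  near \oo => k; exists k%:R.
  have fGk : 'E_P'[excess k%:R \o G]%E \is a fin_num by near: k.
  rewrite -[ltLHS]fineK// lte_fin (le_lt_trans (ler_norm _))//.
  by rewrite -normrN -sub0r; near: k.
have iexc T : excess K \o W T \in Lfun P 1.
  apply: (@bounded_Lfun1 _ _ _ _ _ 1); first exact: measurable_excess.
  by move=> w; exact: excess_normr_le1.
(* A pointwise bound for [A T - B T]: where the cutoff is less than $1$ the vector is bounded and
   the error is at most $e/2$; elsewhere the cutoff equals $1$ and $2M$ suffices. *)
pose C T := cst (e / 2) \+ (2 * M) \o* (excess K \o W T).
have iC T : C T \in Lfun P 1.
  by rewrite rpredD// ?Lfun_cst// Lfun_scale.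
have excW : 'E_P[excess K \o W T]%E @[T --> \oo] --> 'E_P'[excess K \o G]%E.
  apply: YG; first exact: continuous_excess.
  by exists 1; exact: excess_normr_le1.
have e20 : 0 < e / 2 by rewrite divr_gt0.
near=> T.
have lT0 : 0 < l T by near: T; move/cvgryPgt: loo; exact.
have ABC w : `|A T w - B T w| <= C T w.
  have YE : Y T w = x + (l T)^-1 *: W T w.
    by rewrite scalerA mulVf ?gt_eqF// scale1r subrKC.
  rewrite /C /=; have [Kw|Kw] := ltP (excess K (W T w)) 1.
    rewrite ler_wpDr// ?mulr_ge0 ?excess_ge0//.
    rewrite /A /B /= YE ltW//.
    (* Generalizing [W T w] to any vector of norm at most $K+1$ removes [w] from the goal, so one
       threshold on [T] serves all [w]. *)
    have := excess_lt1 Kw; move: (W T w); near: T.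
    exact: scaled_increment_unif.
  have -> : excess K (W T w) = 1 by apply/le_anti; rewrite excess_le1 Kw.
  rewrite mul1r (le_trans (ler_normB _ _))// mulr_natl (mulr2n M).
  apply: (@le_trans _ _ (M + M)); last by rewrite lerDr ltW.
  by apply: lerD; exact: fM.
have excT : ('E_P[excess K \o W T] < (e / (4 * (M + 1)))%:E)%E.
  by near: T; exact: (excW _ (open_ereal_lt' excG)).
have fAB : ('E_P[A T] - 'E_P[B T])%E \is a fin_num.
  by rewrite fin_numB !expectation_fin_num.
rewrite sub0r normrN -lte_fin /= -abse_EFin fineK//.
rewrite (le_lt_trans (dist_expectation_le _ _ (iC T) _))//.
rewrite expectationD ?Lfun_cst ?Lfun_scale// expectation_cst expectationZl//.
rewrite -(fineK (expectation_fin_num (iexc T))) in excT *.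
rewrite -EFinM -EFinD lte_fin; rewrite lte_fin in excT.
have : 0 <= fine 'E_P[excess K \o W T]%E.
  by apply: fine_ge0; apply: expectation_ge0 => w; exact: excess_ge0.
move: excT; rewrite ltr_pdivlMr ?mulr_gt0 ?ltr_pwDr//.
by lra.
Unshelve. all: by end_near. Qed.

End delta_method.

(** * Differentials of $g$, $\sqrt g$ and the root *)

(** Differentiability is local: both maps have the same expansion at [x], and the differential is
    unique. It transfers the differential of the root to the truncated estimator. *)
Lemma near_is_diff (R : numFieldType) (V W : normedModType R) (f h df : V -> W)
    (x : V) :
  is_diff x f df -> {near x, f =1 h} -> is_diff x h df.
Proof.
move=> fdf fh; have [fd <-] := fdf.
have cdf : continuous ('d f x) by exact: diff_continuous.
have hE : h \o shift x = cst (h x) + 'd f x +o_ 0 id.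
  apply/eqaddoP => e e0; have /diff_locally/eqaddoP/(_ _ e0) := fd.
  rewrite -(nbhs_singleton fh).
  have fh0 : \forall v \near (0 : V), f (v + x) = h (v + x).
    have /nbhs_normP[r r0 hr] := fh; apply/nbhs_normP; exists r => // v vr.
    by apply: hr; rewrite /= opprD addrCA subrr addr0 -(add0r (- v)).
  by apply: filterS2 fh0 => v; rewrite !fctE /= => ->.
have dh : 'd h x = 'd f x :> (V -> W) by exact: diff_unique.
by apply: DiffDef => //; apply/diff_locallyP; rewrite dh.
Qed.

Lemma is_diff_coord (R : realType) m n (M : 'M[R]_(m, n)) i j :
  is_diff M (fun N : 'M[R]_(m, n) => N i j) (fun N => N i j).
Proof.
have lin : linear (fun N : 'M[R]_(m, n) => N i j).
  by move=> k u v; rewrite !mxE.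
pose LM := GRing.isLinear.Build _ _ _ _ _ lin.
pose L : {linear 'M[R]_(m, n) -> R} :=
  HB.pack (fun N : 'M[R]_(m, n) => N i j) LM.
apply: DiffDef; first exact: differentiable_coord.
by rewrite (_ : (fun _ => _) = L)// diff_lin//; exact: coord_continuous.
Qed.

Section root_differential.
Context {R : realType} (rN : R).
Implicit Types x v : 'cV[R]_3.

Definition diff_g x v : R :=
  2 * (x 0 0 + x 2 0) * (v 0 0 + v 2 0) + 4 * (rN - 2 * x 1 0) * v 1 0.

Definition diff_sqrt_g x v : R := (2 * sqrt_g rN x)^-1 * diff_g x v.

Definition plus_root x : R := (x 0 0 + x 2 0 + sqrt_g rN x) / (2 * x 1 0).

(** The quotient rule $d(u/(2x_2)) = (du - (u/x_2)\,dx_2)/(2x_2)$ with $u = x_1 + x_3 + \sqrt{g}$;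
    the factor $u/x_2$ is [C_N]. *)
Definition diff_plus_root x v : R :=
  (v 0 0 + v 2 0 + diff_sqrt_g x v - C_N rN x * v 1 0) / (2 * x 1 0).

Lemma is_diff_g x : is_diff x (g rN) (diff_g x).
Proof.
pose c (i : 'I_3) (y : 'cV[R]_3) : R := y i 0.
have dc i : is_diff x (c i) (c i) by exact: is_diff_coord.
have -> : g rN = (c 0 + c 2) ^+ 2 - 4 *: (c 1 * (c 1 - cst rN)).
  by apply/funext => y; rewrite /g /c !fctE /= -mulrA.
apply: is_diff_eq; apply/funext => v; rewrite /diff_g !fctE /= /GRing.scale /=.
rewrite /c (_ : (0 : 'cV[R]_3 -> R) v = 0)//; ring.
Qed.

Lemma is_diff_sqrt_g x : 0 < g rN x -> is_diff x (sqrt_g rN) (diff_sqrt_g x).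
Proof.
move=> g0; have dg := is_diff_g x.
have dsqrt := is_derive1_sqrt g0.
(* The one-variable derivative of the square root, restated as a differential so that the chain rule
   applies. *)
have dS : is_diff (g rN x) (@Num.sqrt R) ( *:%R^~ (2 * Num.sqrt (g rN x))^-1).
  apply: DiffDef; first by apply/derivable1_diffP; exact: ex_derive.
  by rewrite deriv1E ?derive1E ?derive_val//; exact: ex_derive.
rewrite (_ : sqrt_g rN = Num.sqrt \o g rN)//.
apply: (is_diff_eq (is_diff_comp dg dS)); apply/funext => v /=.
exact: mulrC.
Qed.

Lemma is_diff_plus_root x : x 1 0 != 0 -> 0 < g rN x ->
  is_diff x plus_root (diff_plus_root x).
Proof.
move=> x10 g0; have dS := is_diff_sqrt_g g0.
pose c (i : 'I_3) (y : 'cV[R]_3) : R := y i 0.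
have dc i : is_diff x (c i) (c i) by exact: is_diff_coord.
have dV : is_diff x (fun y => (c 1 y)^-1) (- (c 1 x) ^- 2 *: c 1).
  have [cd cE] := dc 1.
  by apply: DiffDef; [exact: differentiableV|rewrite diffV// cE].
have -> : plus_root =
    2^-1 *: ((c 0 + c 2 + sqrt_g rN) * (fun y => (c 1 y)^-1)).
  apply/funext => y; rewrite /plus_root /c !fctE /= /GRing.scale /=.
  by rewrite invfM mulrCA.
apply: is_diff_eq; apply/funext => v; rewrite /diff_plus_root /C_N.
rewrite !fctE /= /GRing.scale /= /c.
by field.
Qed.

End root_differential.

(** * Gradients and the asymptotic variance *)

Lemma gradientE (R : realType) n (f df : 'cV[R]_n -> R) (x : 'cV[R]_n) :
  is_diff x f df -> gradient f x = \col_i df (delta_mx i 0).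
Proof.
move=> fdf; apply/colP => i; rewrite !mxE deriveE ?diff_val//.
Qed.

Lemma gradient_sqrt_g (R : realType) (rN : R) (x : 'cV[R]_3) : 0 < g rN x ->
  gradient (sqrt_g rN) x =
  (Num.sqrt (g rN x))^-1 *:
    vec3 (x 0 0 + x 2 0) (2 * (rN - 2 * x 1 0)) (x 0 0 + x 2 0).
Proof.
move=> g0; have sqrt0 : Num.sqrt (g rN x) != 0 by rewrite gt_eqF ?sqrtr_gt0.
rewrite (gradientE (is_diff_sqrt_g g0)); apply/colP => i.
rewrite !mxE !(tnth_nth 0) /diff_sqrt_g /diff_g /sqrt_g !mxE.
by case: i => -[|[|[|//]]] i3 /=; field.
Qed.

(** Exhibits the gradient of the root, $(\nabla\sqrt g + [1, -C_N, 1]^\top)/(2x_2)$, so that the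
    limit of the delta method is a linear form in [G]. *)
Lemma diff_plus_root_dot (R : realType) (rN : R) (x v : 'cV[R]_3) :
    0 < g rN x ->
  diff_plus_root rN x v =
  (((2 * x 1 0)^-1 *: (gradient (sqrt_g rN) x + vec3 1 (- C_N rN x) 1))^T
     *m v) 0 0.
Proof.
move=> g0; have sqrt0 : Num.sqrt (g rN x) != 0 by rewrite gt_eqF ?sqrtr_gt0.
rewrite gradient_sqrt_g// mxE !big_ord_recl big_ord0 addr0 !mxE.
rewrite !(tnth_nth 0) /=.
rewrite (_ : lift ord0 ord0 = 1); last exact/val_inj.
rewrite (_ : lift ord0 (lift ord0 ord0) = 2); last exact/val_inj.
rewrite /diff_plus_root /diff_sqrt_g /diff_g /sqrt_g mulrC.
set k := (2 * x 1 0)^-1; set C := C_N _ _.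
by field.
Qed.

(** Symmetry of [S] merges the two cross terms, which yields the three-term shape of [Sigma_phi]. *)
Lemma bilform_scaleD (R : realType) n (S : 'M[R]_n) (k : R) (u v : 'cV[R]_n) :
    S^T = S ->
  bilform S (k *: (u + v)) (k *: (u + v)) =
  k ^+ 2 * (bilform S u u + 2 * bilform S v u + bilform S v v).
Proof.
move=> Ssym.
have sym : bilform S u v = bilform S v u.
  have vu : v^T *m S *m u = (u^T *m S *m v)^T.
    by rewrite !trmx_mul trmxK Ssym mulmxA.
  by rewrite /bilform vu [RHS]mxE.
have -> : bilform S (k *: (u + v)) (k *: (u + v)) =
    k ^+ 2 * (bilform S u u + bilform S u v + (bilform S v u + bilform S v v)).
  rewrite /bilform [(k *: _)^T]linearZ/= [(u + v)^T]linearD/=.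
  rewrite -scalemxAl -scalemxAr -scalemxAl !mulmxDl.
  by rewrite !mulmxDr !mxE; ring.
by rewrite sym; ring.
Qed.

(** * Measurability of the estimator and of the observations *)

Section measurability.
Context d (Om : measurableType d) (R : realType).

Lemma measurable_phi_of (rN : R) (W : Om -> 'cV[R]_3) :
  (forall i, measurable_fun setT (fun w => W w i 0)) ->
  measurable_fun setT (fun w => phi_of rN (W w)).
Proof.
move=> mW.
have mg : measurable_fun setT (fun w => g rN (W w)).
  apply: measurable_funB; first exact/measurable_funX/measurable_funD.
  by apply: measurable_funM; [exact: measurable_funM|exact: measurable_funB].
have mt : measurable_fun setT (@trunc01 R).
  apply: measurable_fun_ifT => //; first exact: measurable_fun_ltr.
  by apply: measurable_fun_ifT => //; exact: measurable_fun_ltr.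
apply: (measurableT_comp mt); apply: measurable_fun_ifT => //.
  by apply: measurable_neg; exact: measurable_fun_eqr.
apply: measurable_funM; last first.
  apply: (@measurableT_comp _ _ _ _ _ _ (@GRing.inv R)).
    exact: measurable_invr.
  exact: measurable_funM.
apply: measurable_funD; first exact: measurable_funD.
apply: measurable_fun_ifT => //; first exact: measurable_fun_ltr.
apply: (@measurableT_comp _ _ _ _ _ _ (@Num.sqrt R)) => //.
apply: continuous_measurable_fun.
exact: sqrt_continuous.
Qed.

Lemma measurable_observations (P : probability Om R)
    (X : int -> {RV P >-> R}) T :
  measurable_fun setT (observations X T).
Proof.
apply/measurable_fun_tnthP => i.
rewrite (_ : _ \o _ = X i.+1%:Z)//.
by apply/funext => w /=; rewrite tnth_mktuple.
Qed.

End measurability.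

(** * Local inactivity of the truncation and the indicators *)

(** Each condition that selects a branch of [phi_of] is open and holds at [x], hence persists nearby
    by continuity of the coordinate, of [g] and of the root. *)
Lemma near_phi_of (R : realType) (rN : R) (x : 'cV[R]_3) :
    x 1 0 != 0 -> 0 < g rN x -> 0 < plus_root rN x < 1 ->
  {near x, plus_root rN =1 phi_of rN}.
Proof.
move=> x10 g0 /andP[root0 root1].
have cg : {for x, continuous (g rN)}.
  by apply: differentiable_continuous; have [] := is_diff_g rN x.
have cr : {for x, continuous (plus_root rN)}.
  by apply: differentiable_continuous; have [] := is_diff_plus_root x10 g0.
have cc : {for x, continuous (fun y : 'cV[R]_3 => y 1 0)}.
  exact: coord_continuous.
have x1_neq : nbhs (x 1 0) [set z : R | z != 0].
  by apply: open_nbhs_nbhs; split => //; exact: open_neq.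
near=> y.
have y10 : y 1 0 != 0.
  by near: y; exact: (cc _ x1_neq).
have yg0 : 0 < g rN y by near: y; exact: (cg _ (lt_nbhsr g0)).
have yr0 : 0 < plus_root rN y by near: y; exact: (cr _ (lt_nbhsr root0)).
have yr1 : plus_root rN y < 1 by near: y; exact: (cr _ (lt_nbhsl root1)).
by rewrite /phi_of y10 yg0 -/(plus_root rN y) /trunc01 !ltNge !ltW.
Unshelve. all: by end_near. Qed.

(** * From a normal vector to the normal law of a linear form *)

(** The limit matters only through its law: by change of variables, $a^\top G$ may be replaced by
    the identity on $\mathbb{R}$ under its normal law. *)
Lemma cvg_in_law_normal d (Om : measurableType d) (R : realType)
    (P : probability Om R) d' (Om' : measurableType d')
    (P' : probability Om' R) n (G : Om' -> 'cV[R]_n) (m a : 'cV[R]_n)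
    (S : 'M[R]_n) (Y : nat -> Om -> R) :
    normal_vector P' G m S ->
    cvg_in_law P P' Y (fun w => (a^T *m G w) 0 0) ->
  cvg_in_law P (normal_law ((a^T *m m) 0 0) (bilform S a a)) Y
    (fun x : R => x).
Proof.
move=> /(_ a)[mG GE] YG f cf fM.
pose L w : R := (a^T *m G w) 0 0.
have mf : measurable_fun setT f by exact: continuous_measurable_fun.
pose nu := normal_law ((a^T *m m) 0 0) (bilform S a a).
suff -> : 'E_nu[f \o idfun]%E = 'E_P'[f \o L]%E.
  exact: YG.
have [M fM'] := fM.
rewrite unlock.
(* Retyping [L] selects the measurable structure on which [normal_law] is defined. *)
pose L' : Om' -> measurableTypeR R := L.
have mL : measurable_fun setT L' by exact: mG.
rewrite (@eq_measure_integral _ _ _ _ (pushforward P' L')); last first.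
  by move=> A mA _; apply/esym; exact: GE.
rewrite integral_pushforward//.
- exact/measurable_EFinP.
- rewrite preimage_setT; apply/Lfun1_integrable.
  apply: (@bounded_Lfun1 _ _ _ _ _ M) => [|w]; last exact: fM'.
  exact: measurableT_comp.
Qed.

(** * Asymptotic normality of the estimator of $\phi$ *)

Theorem theorem6 (R : realType) (d : measure_display) (Om : measurableType d)
  (P : probability Om R) (X Z : int -> {RV P >-> R}) (H : R) (N : nat)
  (gammahat : forall T : nat, int -> {mfun T.-tuple R >-> R})
  (Sigma : 'M[R]_3) (l : nat -> R)
  (d' : measure_display) (Om' : measurableType d') (P' : probability Om' R)
  (G : Om' -> 'cV[R]_3) :
  let phi := expR (- H) in
  let gamma := autocov X in
  let r := autocov Z in
  let gam := lag_vec gamma N in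
  let gamhat (T : nat) (w : Om) : 'cV[R]_3 :=
    lag_vec (fun n => gammahat T n (observations X T w)) N in
  let phihat (T : nat) (w : Om) : R := phi_of (r N%:Z) (gamhat T w) in
  0 < H ->
  strictly_stationary X ->
  centered X ->
  finite_second_moments X ->
  strictly_stationary Z ->
  (forall t : int, {ae P, forall w, X t w - phi * X (t - 1) w = Z t w}) ->
  gamma N%:Z != 0 ->
  0 < g (r N%:Z) gam ->
  phi = (gamma (N%:Z + 1) + gamma (N%:Z - 1) + Num.sqrt (g (r N%:Z) gam))
        / (2 * gamma N%:Z) ->
  cvg_in_probability P gamhat gam ->
  covariance_matrix Sigma ->
  (forall T : nat, (0 < T)%N -> 0 < l T) ->
  l T @[T --> \oo] --> +oo ->
  normal_vector P' G 0 Sigma ->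
  cvg_in_law P P' (fun T w => l T *: (gamhat T w - gam)) G ->
  gradient (sqrt_g (r N%:Z)) gam =
    (Num.sqrt (g (r N%:Z) gam))^-1 *:
      vec3 (gamma (N%:Z + 1) + gamma (N%:Z - 1))
           (2 * (r N%:Z - 2 * gamma N%:Z))
           (gamma (N%:Z + 1) + gamma (N%:Z - 1)) /\
  cvg_in_law P (normal_law 0 (Sigma_phi (r N%:Z) gam Sigma))
    (fun T w => l T * (phihat T w - phi)) (fun x : R => x).
Proof.
move=> phi gamma r gam gamhat phihat H0 _ _ _ _ _ gN0 g0 phiE _ [SigS _] _ loo
  GN YG.
have gam0 : gam 0 0 = gamma (N%:Z + 1) by rewrite mxE.
have gam1 : gam 1 0 = gamma N%:Z by rewrite mxE.
have gam2 : gam 2 0 = gamma (N%:Z - 1) by rewrite mxE.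
have x10 : gam 1 0 != 0 by rewrite gam1.
have rootE : plus_root (r N%:Z) gam = phi.
  by rewrite /plus_root gam0 gam1 gam2 phiE.
(* Here $\phi = e^{-H}$ with $H > 0$ places the root strictly inside the truncation interval. *)
have root01 : 0 < plus_root (r N%:Z) gam < 1.
  by rewrite rootE expR_gt0 -expR0 ltr_expR oppr_lt0.
have near_phi := near_phi_of x10 g0 root01.
have phi_gam : phi_of (r N%:Z) gam = phi.
  by rewrite -(nbhs_singleton near_phi) rootE.
split; first by rewrite gradient_sqrt_g// gam0 gam1 gam2.
pose D := gradient (sqrt_g (r N%:Z)) gam.
pose c := vec3 1 (- C_N (r N%:Z) gam) 1.
(* [a] is the gradient at [gam] of the whole estimator map, truncation included. *)
pose a := (2 * gam 1 0)^-1 *: (D + c).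
have dphi : is_diff gam (phi_of (r N%:Z)) (fun v => (a^T *m v) 0 0).
  apply: near_is_diff near_phi; apply: is_diff_eq.
    exact: is_diff_plus_root.
  by apply/funext => v; exact: diff_plus_root_dot.
have -> : Sigma_phi (r N%:Z) gam Sigma = bilform Sigma a a.
  rewrite bilform_scaleD// /Sigma_phi; congr (_ * _).
  by rewrite exprVn exprMn -natrX.
have := cvg_in_law_normal (P := P) (a := a) GN.
rewrite (_ : (a^T *m 0) 0 0 = 0); last by rewrite mulmx0 mxE.
apply.
have -> : (fun w => (a^T *m G w) 0 0) = 'd (phi_of (r N%:Z)) gam \o G.
  by rewrite diff_val.
rewrite /phihat -phi_gam.
have mgamhat T i : measurable_fun setT (fun w => gamhat T w i 0).
  under eq_fun do rewrite mxE (tnth_nth 0).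
  have mhat k :
      measurable_fun setT (fun w => gammahat T k (observations X T w)).
    apply: (@measurableT_comp _ _ _ _ _ _ (gammahat T k)) => //.
    exact: measurable_observations.
  by case: i => -[|[|[|//]]] i3; exact: mhat.
apply: (delta_method mgamhat) => //.
- by move=> T; exact: measurable_phi_of.
(* The coordinates of [G] are the linear forms given by the basis vectors, hence measurable by
   normality. *)
- move=> i; have [mG _] := GN (delta_mx i 0).
  have -> : (fun w => G w i 0) = fun w =>
      ((delta_mx i 0 : 'cV[R]_3)^T *m G w) 0 0.
    by apply/funext => w; rewrite trmx_delta -rowE mxE.
  exact: mG.
Qed.
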